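(* Let $N$ be the size of the ID space. Let $\mathcal{A}$ be a deterministic leader election algorithm in the $\mathsf{Strong}\text{-}\mathsf{CD}$ model that is correct for every set of devices $V \subseteq [N]$ with $|V| \le n$. Let $k$ be its energy complexity and $t$ its time complexity. Then $t \geq \Omega(\min\{n, \frac{N}{2^k}\})$.
   Context: Single-hop radio network: a set $V$ of devices, each device $v$ having a distinct identifier $\mathsf{ID}(v) \in [N] = \{1,\dots,N\}$; $N$ and $n$ are known to all devices. Communication proceeds in synchronous time slots; in each slot each device (based on its ID, the known parameters and all feedback received so far) either stays idle, listens, or transmits a message. In the $\mathsf{Strong}\text{-}\mathsf{CD}$ model, transmitters and listeners receive silence if zero devices transmit, collision if at least two devices transmit, and the message if exactly one device transmits; idle devices receive nothing. Leader election: at termination exactly one device identifies itself as leader and all others as non-leaders. The time complexity is the worst-case number of time slots; the energy complexity is the worst-case maximum over all devices of the number of time slots in which the device listens or transmits. *)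

(* Defs.v *)
From HB Require Import structures.
From mathcomp Require Import all_boot all_order all_algebra.

Set Implicit Arguments.
Unset Strict Implicit.
Unset Printing Implicit Defensive.

Inductive action (M : Type) : Type :=
  | Idle
  | Listen
  | Transmit of M
  | Halt of bool.   (* terminate; the boolean says whether it is the leader *)

Inductive feedback (M : Type) : Type :=
  | NoFeedback      (* what an idle device gets *)
  | Silence
  | Collision
  | Received of M.

Arguments Idle {M}.
Arguments Listen {M}.
Arguments Halt {M}.
Arguments NoFeedback {M}.
Arguments Silence {M}.
Arguments Collision {M}.

(* The ID space is 'I_N = {0, ..., N-1} rather than {1, ..., N}. Histories hold
   one entry per elapsed slot, most recent first, so they carry the current
   time.  Messages range over an arbitrary type M, hence are unbounded. *)
Definition algorithm (N : nat) (M : Type) : Type :=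
  'I_N -> seq (feedback M) -> action M.

Section Execution.

Variables (N : nat) (M : Type) (A : algorithm N M) (V : {set 'I_N}).

(* H gives the history of each device; only devices of V transmit. *)
Definition transmissions (H : 'I_N -> seq (feedback M)) : seq M :=
  pmap (fun v => if A v (H v) is Transmit m then Some m else None) (enum V).

Definition channel (H : 'I_N -> seq (feedback M)) : feedback M :=
  match transmissions H with
  | [::] => Silence
  | [:: m] => Received m
  | _ => Collision
  end.

(* Histories after i slots.  The history of a halted device is frozen, so that
   halting is permanent; values at devices outside V are irrelevant. *)
Fixpoint history (i : nat) : 'I_N -> seq (feedback M) :=
  if i is j.+1 then
    fun v =>
      match A v (history j v) with
      | Idle => NoFeedback :: history j v
      | Listen | Transmit _ => channel (history j) :: history j v
      | Halt _ => history j v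
      end
  else fun _ => [::].

Definition output (i : nat) (v : 'I_N) : option bool :=
  if A v (history i v) is Halt b then Some b else None.

Definition terminated (i : nat) : bool :=
  [forall v in V, output i v != None].

Definition running_time (T : nat) : Prop :=
  terminated T /\ forall i, i < T -> ~~ terminated i.

(* v listens or transmits in the slot following the first i slots *)
Definition awake (i : nat) (v : 'I_N) : bool :=
  match A v (history i v) with
  | Listen | Transmit _ => true
  | Idle | Halt _ => false
  end.

Definition energy (T : nat) (v : 'I_N) : nat := \sum_(i < T) awake i v.

Definition elects_leader : Prop :=
  exists2 T, terminated T & #|[set v in V | output T v == Some true]| = 1.

End Execution.

(* An empty network has no possible leader, so it is not a legal input. *)
Definition legal (N n : nat) (V : {set 'I_N}) : bool := 0 < #|V| <= n.

Definition correct (N n : nat) (M : Type) (A : algorithm N M) : Prop :=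
  forall V, legal n V -> elects_leader A V.

Definition is_maximum (P : nat -> Prop) (m : nat) : Prop :=
  P m /\ forall m', P m' -> m' <= m.

Definition time_complexity (N n : nat) (M : Type) (A : algorithm N M)
    (t : nat) : Prop :=
  is_maximum (fun T => exists2 V, legal n V & running_time A V T) t.

Definition energy_complexity (N n : nat) (M : Type) (A : algorithm N M)
    (k : nat) : Prop :=
  is_maximum (fun e => exists (V : {set 'I_N}) (T : nat) (v : 'I_N),
    [/\ legal n V, running_time A V T, v \in V & e = energy A V T v]) k.

(* Main.v *)
Require Import Defs.
From HB Require Import structures.
From mathcomp Require Import all_boot all_order all_algebra.
From mathcomp Require Import zify.

(** Run every device against a phantom channel on which listeners always hear
    silence and transmitters always hear a collision.  Discarding in each slot
    the lighter of the listeners and the transmitters, where a device weighs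
    [2 ^ (energy spent so far)], leaves at least [N / 2 ^ k] devices among which
    no listener ever coexists with a transmitter.  Discarding at most [2 t] more,
    every slot has either no transmitter or at least three.  Keeping three
    transmitters per slot gives a network [V] of at most [3 t + 2] devices whose
    real execution is the phantom one, and this remains so after removing the
    leader of [V]: the remaining devices then elect nobody. *)

Set Implicit Arguments.
Unset Strict Implicit.
Unset Printing Implicit Defensive.

Import Order.TTheory GRing.Theory Num.Theory.
Local Open Scope nat_scope.

(** * Selecting devices by their activity in each slot *)

Section Selection.

Variable T : finType.
Implicit Types (S V : {set T}) (tx ls : nat -> pred T).

Definition unmixed tx ls t S :=
  forall i u v, i < t -> u \in S -> v \in S -> tx i u -> ~~ ls i v.

Definition crowded d tx t S :=
  forall i v, i < t -> v \in S -> tx i v -> d <= #|[set u in S | tx i u]|.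

Lemma unmixedS tx ls t S V : V \subset S -> unmixed tx ls t S -> unmixed tx ls t V.
Proof. by move=> /subsetP sVS mS i u v it /sVS uS /sVS vS; apply: mS. Qed.

(** In each slot, keep the heavier of two sets: the non-listeners or the non-transmitters. Activity
    doubles a weight, which makes up for the loss, so the total never drops below its initial value
    [#|T|]. *)
Lemma unmixed_weight tx ls t : (forall i v, tx i v -> ~~ ls i v) ->
  exists2 S, unmixed tx ls t S &
    #|T| <= \sum_(v in S) 2 ^ (\sum_(i < t) (tx i v || ls i v)).
Proof.
move=> tx_ls; elim: t => [|t [S mS leS]].
  exists setT => //; rewrite -cardsT -sum1_card; apply: leq_sum => v _.
  by rewrite big_ord0.
pose w v := 2 ^ (\sum_(i < t) (tx i v || ls i v)).
pose S1 := [set v in S | ~~ ls t v]; pose S2 := [set v in S | ~~ tx t v].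
have wS v : 2 ^ (\sum_(i < t.+1) (tx i v || ls i v)) =
            w v + (tx t v || ls t v) * w v.
  by rewrite big_ord_recr /= expnD mulnC -/(w v) -mulSn; case: (_ || _).
pose W S' := \sum_(v in S') (w v + (tx t v || ls t v) * w v).
have split S' p : S' = [set v in S | p v] ->
    W S' = \sum_(v in S) p v * (w v + (tx t v || ls t v) * w v).
  move=> ->; rewrite /W.
  under eq_bigl do rewrite inE.
  by rewrite big_mkcondr; apply: eq_bigr => v _; case: (p v); rewrite ?mul1n.
(* An idle device keeps its weight in both sets; an active one lies in just one of them, with
   doubled weight. *)
have le12 : 2 * (\sum_(v in S) w v) <= W S1 + W S2.
  rewrite (split S1 _ erefl) (split S2 _ erefl) -big_split big_distrr /=.
  apply: leq_sum => v _; have := tx_ls t v.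
  case: (tx t v) => [/(_ isT)/negPf->|_] /=; first by lia.
  by case: (ls t v) => /=; lia.
have mSt S' : S' \subset S ->
    (forall u v, u \in S' -> v \in S' -> tx t u -> ~~ ls t v) ->
    unmixed tx ls t.+1 S'.
  move=> sS' mt i u v; rewrite ltnS leq_eqVlt => /orP[/eqP->|it].
    exact: mt.
  exact: (unmixedS sS' mS) it.
have [le1|lt1] := leqP (\sum_(v in S) w v) (W S1).
  exists S1.
    apply: mSt => [|u v _]; first by apply/subsetP=> v; rewrite inE => /andP[].
    by rewrite inE => /andP[].
  by under eq_bigr do rewrite wS; apply: leq_trans leS le1.
exists S2.
  apply: mSt => [|u v]; first by apply/subsetP=> v; rewrite inE => /andP[].
  by rewrite inE => /andP[_ /negPf->].
under eq_bigr do rewrite wS.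
by apply: leq_trans leS _; rewrite -/(W S2) -/w; move: le12 lt1; rewrite /w; lia.
Qed.

Lemma unmixed_large tx ls t k :
  (forall i v, tx i v -> ~~ ls i v) ->
  (forall v, \sum_(i < t) (tx i v || ls i v) <= k) ->
  exists2 S, unmixed tx ls t S & #|T| <= #|S| * 2 ^ k.
Proof.
move=> tx_ls le_k; have [S mS leS] := unmixed_weight t tx_ls.
exists S => //; apply: (leq_trans leS); rewrite -sum_nat_const.
by apply: leq_sum => v _; rewrite leq_exp2l.
Qed.

(* Emptying a slot with too few transmitters can create another such slot, but
   each slot is emptied only once. *)
Lemma crowded_large d tx t S :
  exists V, [/\ V \subset S, crowded d.+1 tx t V & #|S| <= #|V| + d * t].
Proof.
(* [J] holds the slots not emptied yet; the others stay empty as the set shrinks. So at most [m]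
   slots remain to be emptied, each at the cost of at most [d] devices. *)
suff gen m (J : {set 'I_t}) S' : #|J| <= m ->
    (forall (i : 'I_t) v, i \notin J -> v \in S' -> ~~ tx i v) ->
    exists V, [/\ V \subset S', crowded d.+1 tx t V & #|S'| <= #|V| + d * m].
  by apply: (gen t setT) => [|i v]; rewrite ?cardsT ?card_ord ?inE.
elim: m J S' => [|m IHm] J S' leJ emptyJ.
  exists S'; split; rewrite ?subxx ?leq_addr // => i v it vS txv.
  have /negP[] : ~~ tx (Ordinal it) v.
    apply: emptyJ vS; move: leJ; rewrite leqn0 cards_eq0 => /eqP->.
    by rewrite inE.
  by [].
have [/existsP[i /andP[iJ few]]|/existsPn many] :=
    boolP [exists i : 'I_t, (i \in J) && (#|[set u in S' | tx i u]| <= d)].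
  have [||V [sV cV leV]] := IHm (J :\ i) [set u in S' | ~~ tx i u].
  - by move: leJ; rewrite (cardsD1 i J) iJ.
  - move=> j v; rewrite !inE negb_and negbK => /orP[/eqP->|jJ] /andP[vS] //.
    by move=> _; apply: emptyJ.
  exists V; split=> //.
    by apply: subset_trans sV _; apply/subsetP=> v; rewrite inE => /andP[].
  have: #|S'| = #|[set u in S' | tx i u]| + #|[set u in S' | ~~ tx i u]|.
    rewrite -(cardsID [set u | tx i u] S'); congr (_ + _).
      by apply: eq_card => v; rewrite !inE.
    by apply: eq_card => v; rewrite !inE andbC.
  by move=> ->; rewrite mulnS; lia.
exists S'; split; rewrite ?subxx ?leq_addr // => i v it vS txv.
have [iJ|/emptyJ/(_ vS)] := boolP (Ordinal it \in J); last by rewrite /= txv.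
by have := many (Ordinal it); rewrite iJ /= -ltnNge.
Qed.

Lemma card_subset S d : exists V, [/\ V \subset S, #|V| <= d & minn d #|S| <= #|V|].
Proof.
have [V /andP[sV /eqP cV]] : exists V, (V \subset S) && (#|V| == minn d #|S|).
  have /card_gt0P[V] : 0 < #|[set V : {set T} | V \subset S & #|V| == minn d #|S|]|.
    by rewrite cards_draws bin_gt0 geq_minr.
  by rewrite inE; exists V.
by exists V; rewrite cV geq_minl.
Qed.

(** Take two arbitrary devices, so that one survives the removal of a leader, and add [d]
    transmitters for each slot in which [S] has any. *)
Lemma crowded_small d tx t S : crowded d tx t S ->
  exists V, [/\ V \subset S, crowded d tx t V,
    minn 2 #|S| <= #|V| & #|V| <= d * t + 2].
Proof.
move=> cS.
(* Here [v] ranges over [S], not [V]: a device added for a later slot may also transmit in an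
   earlier one. *)
suff gen s : s <= t -> exists V, [/\ V \subset S,
    (forall i v, i < s -> v \in S -> tx i v -> d <= #|[set u in V | tx i u]|),
    minn 2 #|S| <= #|V| & #|V| <= d * s + 2].
  have [V [sV cV geV leV]] := gen t (leqnn t).
  by exists V; split=> // i v it /(subsetP sV); apply: cV.
elim: s => [|s IHs] lest.
  by have [V [sV leV geV]] := card_subset S 2; exists V; rewrite muln0.
have [V [sV cV geV leV]] := IHs (ltnW lest).
have [B [sB leB geB]] := card_subset [set u in S | tx s u] d.
exists (V :|: B); split.
- rewrite subUset sV (subset_trans sB) //.
  by apply/subsetP=> v; rewrite inE => /andP[].
- move=> i v; rewrite ltnS leq_eqVlt => /orP[/eqP->|lis] vS txv.
    have := cS s v lest vS txv => dS.
    apply: leq_trans (_ : #|B| <= _); first by lia.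
    apply: subset_leq_card; apply/subsetP=> u uB; rewrite !inE uB orbT /=.
    by have:= subsetP sB u uB; rewrite inE => /andP[].
  apply: leq_trans (cV i v lis vS txv) _; apply: subset_leq_card.
  by apply/subsetP=> u; rewrite !inE => /andP[-> ->].
- by apply: leq_trans geV _; apply: subset_leq_card; apply: subsetUl.
- by have := cardsU V B; lia.
Qed.

Lemma crowdedW d e tx t S : e <= d -> crowded d tx t S -> crowded e tx t S.
Proof. by move=> led cS i v it vS txv; apply: leq_trans led (cS i v it vS txv). Qed.

(** Each slot loses at most one transmitter. This is why three are kept per slot although two
    already collide. *)
Lemma crowdedD1 d tx t S x : crowded d.+1 tx t S -> crowded d tx t (S :\ x).
Proof.
move=> cS i v it; rewrite inE => /andP[_ vS] txv.
have := cS i v it vS txv; rewrite (cardsD1 x).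
have -> : [set u in S | tx i u] :\ x = [set u in S :\ x | tx i u].
  by apply/setP=> u; rewrite !inE andbA.
by case: (_ \in _); lia.
Qed.

End Selection.

(** * Real executions and the phantom execution *)

Section Execution.

Variables (N : nat) (M : Type) (A : algorithm N M).

Lemma output_stable V i j v b : i <= j ->
  output A V i v = Some b -> output A V j v = Some b.
Proof.
move=> /subnK<-; elim: (j - i) => // m IHm /IHm; rewrite addSn /output /=.
by case E: (A v (history A V (m + i) v)) => [||?|c] //= <-; rewrite E.
Qed.

Lemma terminated_stable V i j : i <= j -> terminated A V i -> terminated A V j.
Proof.
move=> leij /forall_inP tm; apply/forall_inP=> v /tm.
by case E: (output A V i v) => [b|] // _; rewrite (output_stable leij E).
Qed.

(** Outputs are permanent, so those at any terminated time are already those at the running time.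
    Different networks can thus be inspected at one common time. *)
Lemma elects_leader_running V : elects_leader A V ->
  exists2 T, running_time A V T &
    forall i, T <= i -> #|[set v in V | output A V i v == Some true]| = 1.
Proof.
case=> T0 tm0 <-; have ex : exists T, terminated A V T by exists T0.
case: (ex_minnP ex) => T tm minT; exists T.
  by split=> // i; rewrite ltnNge; apply/contra/minT.
move=> i leTi; apply: eq_card => v; rewrite !inE.
have [vV|] //= := boolP (v \in V).
have := forall_inP tm v vV; case E: (output A V T v) => [b|] // _.
by rewrite (output_stable leTi E) (output_stable (minT _ tm0) E).
Qed.

(** No network occurs here: the phantom history of a device depends on its identifier alone, hence
    is shared by all networks containing it. *)
Fixpoint phantom (i : nat) : 'I_N -> seq (feedback M) :=
  if i is j.+1 then
    fun v =>
      match A v (phantom j v) with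
      | Idle => NoFeedback :: phantom j v
      | Listen => Silence :: phantom j v
      | Transmit _ => Collision :: phantom j v
      | Halt _ => phantom j v
      end
  else fun _ => [::].

Definition transmits (i : nat) (v : 'I_N) : bool :=
  if A v (phantom i v) is Transmit _ then true else false.

Definition listens (i : nat) (v : 'I_N) : bool :=
  if A v (phantom i v) is Listen then true else false.

Definition spent (i : nat) (v : 'I_N) : nat :=
  \sum_(j < i) (transmits j v || listens j v).

(* Only devices that take part in a legal real execution are known to spend at
   most [k], so in the phantom execution spending is cut off at [k]. *)
Definition capped (k : nat) (act : nat -> pred 'I_N) (i : nat) (v : 'I_N) : bool :=
  act i v && (spent i v < k).

Lemma capped_transmits_listens k i v :
  capped k transmits i v -> ~~ capped k listens i v.
Proof. by rewrite /capped /transmits /listens; case: (A v _). Qed.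

Lemma sum_capped k t v :
  \sum_(i < t) (capped k transmits i v || capped k listens i v) <= k.
Proof.
(* The bound by [spent t v] makes the induction work: below the cap both sums grow together, and at
   the cap the left one stops. *)
suff: \sum_(i < t) (capped k transmits i v || capped k listens i v) <=
      minn k (spent t v) by lia.
elim: t => [|t IHt]; first by rewrite big_ord0.
rewrite big_ord_recr /= /spent big_ord_recr /= -/(spent t v).
move: (\sum_(i < t) _) IHt => c IHt; rewrite /capped.
by case: (transmits t v); case: (listens t v);
  case: (ltnP (spent t v) k) => /=; lia.
Qed.

Lemma channel_silence (V : {set 'I_N}) i :
  (forall v, v \in V -> history A V i v = phantom i v) ->
  (forall v, v \in V -> ~~ transmits i v) ->
  channel A V (history A V i) = Silence.
Proof.
move=> eqh noT; rewrite /channel.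
suff /size0nil-> : size (transmissions A V (history A V i)) = 0 by [].
rewrite size_pmap; apply/eqP; rewrite -leqn0 leqNgt -has_count; apply/hasPn=> v.
rewrite mem_enum => vV; have := noT v vV; rewrite /transmits -eqh //=.
by case: (A v _).
Qed.

Lemma channel_collision (V : {set 'I_N}) i :
  (forall v, v \in V -> history A V i v = phantom i v) ->
  1 < #|[set v in V | transmits i v]| ->
  channel A V (history A V i) = Collision.
Proof.
move=> eqh manyT; rewrite /channel.
suff: 1 < size (transmissions A V (history A V i)) by case: (transmissions _ _ _) => [|? []].
rewrite size_pmap; apply: leq_trans manyT _.
rewrite cardE -size_filter; apply: uniq_leq_size (enum_uniq _) _ => v.
rewrite mem_enum inE mem_filter mem_enum /transmits => /andP[vV].
by rewrite -eqh //= vV andbT; case: (A v _).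
Qed.

(** By strong induction on time: agreement so far makes phantom spending real, so the cap [k]
    excludes no action of [V], and the selection properties then determine the next feedback. *)
Lemma history_phantom n k t (V : {set 'I_N}) :
  legal n V -> correct n A -> energy_complexity n A k ->
  unmixed (capped k transmits) (capped k listens) t V ->
  crowded 2 (capped k transmits) t V ->
  forall i v, i <= t -> v \in V -> history A V i v = phantom i v.
Proof.
move=> lV corr [_ maxk] mV cV i.
have [T rT _] := elects_leader_running (corr V lV).
elim/ltn_ind: i => -[|i] // IH v it vV.
have eqh j u : j <= i -> u \in V -> history A V j u = phantom j u.
  by move=> lej; apply: IH; lia.
have awakeE j u : j <= i -> u \in V -> awake A V j u = transmits j u || listens j u.
  by move=> lej uV; rewrite /awake /transmits /listens eqh //; case: (A u _).
(* A device active in slot [i] has not halted, so this slot precedes [T] and counts towards its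
   energy: [spent i u + 1 <= k]. *)
have spent_lt u : u \in V -> transmits i u || listens i u -> spent i u < k.
  move=> uV actu; have ltiT : i < T.
    rewrite ltnNge; apply/negP=> leTi.
    have /forall_inP/(_ u uV) := terminated_stable leTi rT.1.
    by rewrite /output eqh //; move: actu; rewrite /transmits /listens; case: (A u _).
  apply: leq_trans (maxk _ (ex_intro _ V (ex_intro _ T (ex_intro _ u
    (And4 lV rT uV erefl))))).
  rewrite /energy -(subnKC ltiT) big_split_ord /= big_ord_recr /=.
  rewrite awakeE // actu addn1.
  have -> : \sum_(j < i) awake A V j u = spent i u; last by lia.
  by apply: eq_bigr => j _; rewrite awakeE // ltnW.
have capT u : u \in V -> capped k transmits i u = transmits i u.
  move=> uV; rewrite /capped; case E: (transmits i u) => //=.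
  by apply: spent_lt; rewrite ?E.
have capL u : u \in V -> capped k listens i u = listens i u.
  move=> uV; rewrite /capped; case E: (listens i u) => //=.
  by apply: spent_lt; rewrite ?E ?orbT.
(* A listener [v] excludes transmitters by [mV]; a transmitter [v] is not alone by [cV]. *)
rewrite /= (eqh i v) //; case E: (A v (phantom i v)) => [| |m|b] //.
  rewrite channel_silence // => [u|u uV]; first exact: eqh.
  apply/negP=> txu; have := mV i u v it uV vV.
  by rewrite capT // capL // txu /listens E => /(_ isT).
rewrite channel_collision // => [u|]; first exact: eqh.
have := cV i v it vV; rewrite capT // {1}/transmits E => /(_ isT) /leq_trans; apply.
apply: subset_leq_card; apply/subsetP=> u; rewrite !inE => /andP[uV].
by rewrite capT // uV.
Qed.

(** The bound [3 * t + 2] makes the selected network legal; [2 * t + 2] pays for the [2 * t] devices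
    discarded and the two that must remain. *)
Lemma no_fast_thrifty_election n k t :
  correct n A -> energy_complexity n A k -> time_complexity n A t ->
  3 * t + 2 <= n -> N < (2 * t + 2) * 2 ^ k.
Proof.
move=> corr enk [_ maxt] len; rewrite ltnNge; apply/negP=> leN.
have [S mS] := unmixed_large (@capped_transmits_listens k) (sum_capped k t); rewrite card_ord => leS.
have [S' [sS' cS' leS']] := crowded_large 2 (capped k transmits) t S.
have geS : 2 * t + 2 <= #|S|.
  by rewrite -(leq_pmul2r (expn_gt0 2 k)) (leq_trans leN).
have [V [sV cV geV leV]] := crowded_small cS'.
have mV := unmixedS (subset_trans sV sS') mS.
have elected W : legal n W ->
    #|[set v in W | output A W t v == Some true]| = 1.
  move=> lW; have [T rT] := elects_leader_running (corr W lW).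
  by apply; apply: maxt; exists W.
have V2 : 1 < #|V| by lia.
have lV : legal n V by rewrite /legal (ltnW V2) (leq_trans leV).
have /eqP/cards1P[x leader] := elected V lV.
have xV : x \in V by have := set11 x; rewrite -leader inE => /andP[].
have lW : legal n (V :\ x).
  move: V2 leV; rewrite /legal (cardsD1 x V) xV add1n ltnS => -> /ltnW leV.
  exact: leq_trans len.
have hV := history_phantom lV corr enk mV (crowdedW (leqnSn 2) cV) (leqnn t).
have hW := history_phantom lW corr enk
  (unmixedS (subsetDl _ _) mV) (crowdedD1 (x := x) cV) (leqnn t).
(* The leader [y] of [V :\ x] has the same history in [V], where it would be a leader besides
   [x]. *)
have /eqP/cards1P[y] := elected _ lW => /setP/(_ y).
rewrite !inE eqxx => /andP[/andP[yx yV]].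
have yW : y \in V :\ x by rewrite !inE yx.
rewrite /output hW // -hV // => outy.
have : y \in [set v in V | output A V t v == Some true] by rewrite inE yV.
by rewrite leader inE (negPf yx).
Qed.

(** In zero slots no energy is spent, so [k = 0] and the previous bound gives [N < 2]. Positivity of
    [t] lets a constant factor absorb the additive terms. *)
Lemma time_gt0 n k t : 1 < N -> 1 < n ->
  correct n A -> energy_complexity n A k -> time_complexity n A t -> 0 < t.
Proof.
move=> N1 n1 corr enk tc; case: t tc => // tc.
have := no_fast_thrifty_election corr enk tc n1.
have -> : k = 0; last by lia.
case: enk => -[V [T [v [lV rT vV ->]]]] _.
have : T <= 0 by apply: tc.2; exists V.
by case: T rT => // _ _; rewrite /energy big_ord0.
Qed.

End Execution.

Local Open Scope ring_scope.

Theorem theorem4p3 :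
  exists2 c : rat, 0 < c &
    forall (N n : nat) (M : Type) (A : algorithm N M) (k t : nat),
      (1 < N)%N -> (1 < n)%N ->
      correct n A -> energy_complexity n A k -> time_complexity n A t ->
      c * Num.min n%:R (N%:R / 2 ^+ k) <= t%:R.
Proof.
(* As [t > 0], both [3 * t + 1] (bounding [n] in one case) and [2 * t + 2] (the factor in the other)
   are at most [4 * t]. *)
exists (4^-1) => // N n M A k t N1 n1 corr enk tc.
have t0 := time_gt0 N1 n1 corr enk tc.
rewrite mulrC ler_pdivrMr // ge_min.
have [small|large] := leqP (3 * t + 2) n; apply/orP; [right|left].
  have lt := no_fast_thrifty_election corr enk tc small.
  rewrite ler_pdivrMr ?exprn_gt0 // -natrX -!natrM ler_nat.
  apply: leq_trans (ltnW lt) _; rewrite leq_mul2r; apply/orP; right; lia.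
by rewrite -natrM ler_nat; lia.
Qed.
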